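(* Consider the following iterative rounding algorithm. Input: a graph $G=(V,E)$ with vertex costs $c:V\to\mathbb{R}_{\ge0}$. Initialize $H_0=G$, $R_0=\emptyset$, $i=0$. While $H_i$ contains a cycle: let $x^{(i)}$ be the vector returned by the subroutine Produce-Witness on $(H_i,c)$, let $A_i=\{u\in V(H_i):x^{(i)}_u\ge 1/2\}$, set $R_{i+1}=R_i\cup A_i$ and $H_{i+1}=H_i-A_i$, and increment $i$. Return $R=R_i$. Then the returned set $R$ is a feedback vertex set of $G$ with $\sum_{u\in R}c_u\le 2\,\mathrm{OPT}$, where $\mathrm{OPT}$ is the minimum cost of a feedback vertex set of $G$.
   Context: Graphs are finite, undirected, simple and loopless. A feedback vertex set of $G$ is a set $R\subseteq V$ such that $G-R$ has no cycles; its cost is $\sum_{u\in R}c_u$. For $S\subseteq V$, $E[S]$ is the edge set of the induced subgraph $G[S]$ and $d_S(u)$ the degree of $u$ in $G[S]$. The strong density polyhedron is $$P_{SD}(G)=\Big\{x\in[0,1]^V:\ \sum_{u\in S}(d_S(u)-1)x_u\ge |E[S]|-|S|+1\quad\text{for all } S\subseteq V \text{ with } E[S]\neq\emptyset\Big\}.$$ Produce-Witness is a subroutine that, given a graph $H=(W,F)$ containing a cycle and non-negative vertex costs $c$, returns a vector $x^*\in\mathbb{R}^W_{\ge0}$ such that (i) $c^Tx^*\le\min\{c^Tx:x\in P_{SD}(H)\}$; (ii) there exists $u\in W$ with $x^*_u\ge1/2$; (iii) for $A=\{u\in W:x^*_u\ge1/2\}$, the restriction of $x^*$ to $W\setminus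 A$ lies in $P_{SD}(H-A)$. *)

(* Defs.v *)
From HB Require Import structures.
From mathcomp Require Import all_boot all_order all_algebra.

Set Implicit Arguments.
Unset Strict Implicit.
Unset Printing Implicit Defensive.

Import Order.TTheory GRing.Theory Num.Theory.
Local Open Scope ring_scope.

(* A finite simple graph whose vertices are drawn from an ambient finite type
   T, so that G and all the graphs G - A have the same type. *)
Record sgraph (T : finType) := SGraph {
  verts : {set T};
  edges : {set {set T}};
  edgesP : [forall f in edges, (#|f| == 2) && (f \subset verts)]
}.

Section Graphs.
Context {T : finType}.
Implicit Types (G H : sgraph T) (S A F : {set T}).

Definition adj G : rel T := fun u v => [set u; v] \in edges G.

Definition deg G (u : T) : nat := #|[set f in edges G | u \in f]|.

Lemma induced_subproof G S :
  [forall f in [set f in edges G | f \subset S],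
    (#|f| == 2) && (f \subset verts G :&: S)].
Proof.
apply/forall_inP => f; rewrite inE => /andP[fG fS].
by have /andP[-> fV] := forall_inP (edgesP G) f fG; rewrite subsetI fV fS.
Qed.

Definition induced G S : sgraph T := SGraph (induced_subproof G S).

Definition delete G A : sgraph T := induced G (verts G :\: A).

(* The length of a cycle is bounded by #|T| only to get a boolean predicate;
   see [has_cycleP]. *)
Definition has_cycle G : bool :=
  [exists n : 'I_#|T|.+1, exists s : n.-tuple T,
    [&& (2 < n)%N, cycle (adj G) s & uniq s]].

Lemma has_cycleP G :
  reflect (exists2 s : seq T, (2 < size s)%N & ucycle (adj G) s) (has_cycle G).
Proof.
apply: (iffP existsP) => [[n /existsP[s /and3P[n_gt2 cs us]]]|[s s_gt2]].
  by exists s; rewrite ?size_tuple // /ucycle cs us.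
move=> /andP[cs us]; have sT : (size s < #|T|.+1)%N.
  by rewrite ltnS -(card_uniqP us) max_card.
by exists (Ordinal sT); apply/existsP; exists (in_tuple s); rewrite /= s_gt2 cs.
Qed.

Definition feedback_vertex_set G F : bool :=
  (F \subset verts G) && ~~ has_cycle (delete G F).

Lemma feedback_vertex_set_verts G : feedback_vertex_set G (verts G).
Proof.
rewrite /feedback_vertex_set subxx /=; apply/negP => /has_cycleP[[|u s]] //= _.
case/andP; case: s => [|v s] /= /andP[] + _ _; rewrite /adj inE => /andP[_];
by rewrite setDv => /subsetP/(_ u); rewrite !inE eqxx => /(_ isT).
Qed.

End Graphs.

Section Algorithm.
Context {R : realFieldType} {T : finType}.
Implicit Types (G H : sgraph T) (A F S : {set T}) (c x : {ffun T -> R}).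

Definition cost c F : R := \sum_(u in F) c u.

Definition OPT G c : R :=
  cost c [arg min_(F < verts G | feedback_vertex_set G F) cost c F]%O.

Lemma OPT_min G c :
  (exists2 F, feedback_vertex_set G F & cost c F = OPT G c) /\
  (forall F, feedback_vertex_set G F -> OPT G c <= cost c F).
Proof.
rewrite /OPT; case: Order.TotalTheory.arg_minP => [|F Ffvs Fmin].
  exact: feedback_vertex_set_verts.
by split=> //; exists F.
Qed.

(* Vectors indexed by the vertices of a graph are represented by functions on
   T, of which only the values on [verts H] are relevant. *)
Definition dot H c x : R := \sum_(u in verts H) c u * x u.

Definition strong_density H x : Prop :=
  (forall u, u \in verts H -> 0 <= x u <= 1) /\
  (forall S, S \subset verts H -> edges (induced H S) != set0 ->
     #|edges (induced H S)|%:R - #|S|%:R + 1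
       <= \sum_(u in S) ((deg (induced H S) u)%:R - 1) * x u).

Definition rounded H x : {set T} := [set u in verts H | 1 / 2 <= x u].

Definition witness H c x : Prop :=
  [/\ forall u, u \in verts H -> 0 <= x u,
      forall y, strong_density H y -> dot H c x <= dot H c y,
      exists2 u, u \in verts H & 1 / 2 <= x u
    & strong_density (delete H (rounded H x)) x].

Definition witness_producer
    (PW : sgraph T -> {ffun T -> R} -> {ffun T -> R}) : Prop :=
  forall H c, has_cycle H -> (forall u, u \in verts H -> 0 <= c u) ->
    witness H c (PW H c).

(* [rounding_returns PW c H R0 R1]: the while loop, entered with current graph
   H and current set R0, terminates and returns R1. *)
Inductive rounding_returns (PW : sgraph T -> {ffun T -> R} -> {ffun T -> R}) c :
    sgraph T -> {set T} -> {set T} -> Prop :=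
| rounding_stop H R0 :
    ~~ has_cycle H -> rounding_returns PW c H R0 R0
| rounding_step H R0 R1 :
    has_cycle H ->
    rounding_returns PW c (delete H (rounded H (PW H c)))
      (R0 :|: rounded H (PW H c)) R1 ->
    rounding_returns PW c H R0 R1.

End Algorithm.

(* Main.v *)
(* For every y in P_SD(H), the set chosen by the loop started at H costs at
   most 2 c^T y: the vertices of A cost at most twice their share of c^T x*,
   the rest is bounded by induction applied to the restriction of x* itself,
   which lies in P_SD(H - A), and c^T x* <= c^T y. The bound against OPT
   follows since the indicator vector of a feedback vertex set F lies in
   P_SD(G), because the forest G[S - F], if nonempty, has fewer edges than
   vertices. *)
Require Import Defs.
From mathcomp Require Import all_boot all_order all_algebra.
From mathcomp Require Import lra zify.

Set Implicit Arguments.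
Unset Strict Implicit.
Unset Printing Implicit Defensive.

Import Order.TTheory GRing.Theory Num.Theory.
Local Open Scope ring_scope.

Section Forests.
Context {T : finType}.
Implicit Types (G H : sgraph T) (S A B F : {set T}).

Lemma adj_sym G : symmetric (adj G).
Proof. by move=> u v; rewrite /adj setUC. Qed.

Lemma edges_card2 G f : f \in edges G -> #|f| = 2.
Proof. by move=> /(forall_inP (edgesP G))/andP[/eqP]. Qed.

Lemma edges_verts G f : f \in edges G -> f \subset verts G.
Proof. by move=> /(forall_inP (edgesP G))/andP[]. Qed.

Lemma adj_neq G u v : adj G u v -> u != v.
Proof. by move=> /edges_card2; rewrite cards2; case: eqVneq. Qed.

Lemma edges_adj G f u : f \in edges G -> u \in f ->
  exists2 v, f = [set u; v] & adj G u v.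
Proof.
move=> fG uf; have /eqP/cards2P[a [b [_ fE]]] := edges_card2 fG.
move: uf; rewrite fE in fG *; rewrite !inE => /orP[]/eqP->.
  by exists b.
by exists a; rewrite /adj setUC.
Qed.

Lemma sub_has_cycle G H :
  edges G \subset edges H -> has_cycle G -> has_cycle H.
Proof.
move=> /subsetP sGH /has_cycleP[s s_gt2 /andP[cs us]].
apply/has_cycleP; exists s => //; apply/andP; split=> //.
by apply: sub_cycle cs => u v; apply: sGH.
Qed.

(** The edge [x z] closes the initial segment of the path ending at [z]. Taking [z] beyond the first
    vertex of [s] ensures that this cycle has at least three vertices. *)
Lemma path_chord_cycle G x s z :
  path (adj G) x s -> uniq (x :: s) -> adj G x z -> z \in behead s ->
  has_cycle G.
Proof.
case: s => [//|y s] /= /andP[xy ys] us xz zs.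
case/path.splitP: zs ys us => s1 s2.
rewrite cat_path => /andP[ps1 _].
rewrite -!cons_uniq -!cat_cons cat_uniq => /andP[us _].
apply/has_cycleP; exists [:: x, y & rcons s1 z]; first by rewrite /= size_rcons.
by rewrite /ucycle us /= xy rcons_path ps1 last_rcons adj_sym xz.
Qed.

(* Otherwise every path could be extended at its head. *)
Lemma forest_leaf G S : ~~ has_cycle G -> S != set0 ->
  exists2 u, u \in S & (deg (induced G S) u <= 1)%N.
Proof.
move=> acG /set0Pn[u0 u0S]; apply/exists_inP; apply: contraT.
rewrite negb_exists_in => /forall_inP deg_gt1.
have long n : exists x s,
    [/\ x \in S, path (adj G) x s, uniq (x :: s) & size s = n].
  elim: n => [|n [x [s [xS ps us sz]]]]; first by exists u0, [::].
  (* A second edge at [x], other than the one back to its successor on the path. For empty [s] the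
     default makes the removed set [[set x; x]], which is no edge. *)
  have : [set f in edges (induced G S) | x \in f]
           :\ [set x; head x s] != set0.
    have := deg_gt1 x xS; rewrite -ltnNge /deg (cardsD1 [set x; head x s]).
    by rewrite -card_gt0; case: (_ \in _) => //; apply: ltnW.
  case/set0Pn => f; rewrite !inE => /and3P[fN /andP[fG fS] xf].
  have [z fE xz] := edges_adj fG xf.
  have zS : z \in S by rewrite (subsetP fS) // fE !inE eqxx orbT.
  exists z, (x :: s); split=> //=; rewrite ?sz //; first by rewrite adj_sym xz.
  move: us => /= us; rewrite us andbT inE negb_or eq_sym (adj_neq xz) /=.
  apply/negP => zs; move/negP: acG; apply.
  apply: (path_chord_cycle ps us xz).
  case: {ps us sz deg_gt1} s fN zs => //= y s fN.
  by rewrite inE => /orP[/eqP zy|//]; rewrite fE zy eqxx in fN.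
(* With [x] included, this path has [#|T|] + 1 distinct vertices. *)
have [x [s [_ _ us sz]]] := long #|T|.
by have := max_card [in x :: s]; rewrite (card_uniqP us) /= sz ltnn.
Qed.

(** Removing a leaf loses one vertex and at most one edge. *)
Lemma forest_edges G S : ~~ has_cycle G -> S != set0 ->
  (#|edges (induced G S)| < #|S|)%N.
Proof.
move=> acG; have [n] := ubnP #|S|; elim: n S => // n IH S.
rewrite ltnS => Sn S0; have [u uS du] := forest_leaf acG S0.
have Edel : edges (induced G S) :\: [set f in edges (induced G S) | u \in f]
    = edges (induced G (S :\ u)).
  apply/setP => f; rewrite !inE subsetD1.
  by case: (f \in edges G); case: (f \subset S); case: (u \in f).
have := cardsID [set f in edges (induced G S) | u \in f] (edges (induced G S)).
rewrite Edel (setIidPr _); last by apply/subsetP => f; rewrite inE => /andP[].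
move: du; rewrite /deg => du <-.
have cS := cardsD1 u S; rewrite uS in cS.
(* The induction hypothesis needs a nonempty set; a single vertex spans no edge. *)
have [Su0|Su0] := eqVneq (S :\ u) set0.
  have -> : #|edges (induced G (S :\ u))| = 0%N.
    apply/eqP; rewrite cards_eq0; apply/set0Pn => -[f].
    rewrite inE Su0 subset0 => /andP[/edges_card2 + /eqP f0].
    by rewrite f0 cards0.
  suff : (#|[set f in edges (induced G S) | u \in f]| = 0)%N by lia.
  apply/eqP; rewrite cards_eq0; apply/set0Pn => -[f].
  rewrite !inE => /andP[/andP[/edges_card2 f2 fS] _].
  by have := subset_leq_card fS; rewrite cS Su0 cards0 f2.
have := IH _ _ Su0; lia.
Qed.

(** Double counting of the incidences between edges and vertices of [A]. *)
Lemma sum_deg G A :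
  (\sum_(u in A) deg G u = \sum_(f in edges G) #|f :&: A|)%N.
Proof.
under eq_bigr => u _ do rewrite /deg -sum1dep_card.
rewrite (exchange_big_dep (mem (edges G))) /=; last by move=> u f _ /andP[].
apply: eq_bigr => f fG; rewrite -sum1_card; apply: eq_bigl => u.
by rewrite !inE fG andbC.
Qed.

(** An edge of G[S] either avoids [F], or is counted at least once in the degree sum over S ∩ F. *)
Lemma card_edges_induced_le G S F :
  (#|edges (induced G S)| <=
     \sum_(u in S :&: F) deg (induced G S) u
     + #|edges (induced G (S :\: F))|)%N.
Proof.
rewrite sum_deg -[leqLHS](cardsID (edges (induced G (S :\: F)))) [leqRHS]addnC.
apply: leq_add; first by rewrite subset_leq_card ?subsetIr.
rewrite [leqRHS](big_setID (edges (induced G (S :\: F)))) /= -sum1_card.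
apply: leq_trans (leq_addl _ _); apply: leq_sum => f.
rewrite !inE subsetD => /andP[+ /andP[fG fS]].
by rewrite fG fS /= card_gt0 setIA (setIidPl fS) setI_eq0.
Qed.

End Forests.

Section Rounding.
Context {R : realFieldType} {T : finType}.
Implicit Types (G H : sgraph T) (A B F S : {set T}) (c x y : {ffun T -> R}).

Lemma fvs_strong_density G F : feedback_vertex_set G F ->
  strong_density G [ffun u => (u \in F)%:R : R].
Proof.
move=> /andP[_ acF]; split=> [u _|S SG E0].
  by rewrite ffunE; case: (u \in F); rewrite ?lexx ?ler01.
have -> : \sum_(u in S) ((deg (induced G S) u)%:R - 1)
      * [ffun u => (u \in F)%:R : R] u
    = (\sum_(u in S :&: F) deg (induced G S) u)%:R - #|S :&: F|%:R.
  rewrite natr_sum -sum1_card natr_sum -sumrB (big_setID F) /= [X in _ + X]big1.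
    by rewrite addr0; apply: eq_bigr => u /setIP[_ uF]; rewrite ffunE uF mulr1.
  by move=> u /setDP[_ /negbTE uF]; rewrite ffunE uF mulr0.
have cS := cardsID F S.
(* The constraint over the naturals, rearranged by |S| = |S ∩ F| + |S - F| to avoid subtraction. *)
suff le : (#|edges (induced G S)| + #|S :&: F| + 1
    <= \sum_(u in S :&: F) deg (induced G S) u + #|S|)%N.
  by move: le; rewrite -(ler_nat R) !natrD; lra.
(* If S ⊆ F there is no forest to count; the degree sum is 2|E[S]|, and E[S] ≠ ∅ gives |E[S]| + 1 ≤
   2|E[S]|. *)
have [SF|SF] := eqVneq (S :\: F) set0.
  have SFE : S :&: F = S by apply/setIidPl; rewrite -setD_eq0 SF.
  rewrite SFE sum_deg; rewrite (eq_bigr (fun=> 2%N)); last first.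
    move=> f; rewrite inE => /andP[/edges_card2 f2 fS].
    by rewrite (setIidPl fS).
  by rewrite sum_nat_const; move: E0; rewrite -card_gt0; lia.
have := card_edges_induced_le G S F.
have : (#|edges (induced G (S :\: F))| < #|S :\: F|)%N.
  apply: leq_ltn_trans (forest_edges acF SF); apply: subset_leq_card.
  apply/subsetP => f; rewrite !inE => /andP[fG fS].
  by rewrite fG fS (subset_trans fS) ?setSD.
lia.
Qed.

Variables (PW : sgraph T -> {ffun T -> R} -> {ffun T -> R}) (c : {ffun T -> R}).
Hypothesis hPW : witness_producer PW.

Lemma verts_delete H A : verts (delete H A) = verts H :\: A.
Proof. by rewrite /=; apply/setIidPr; apply: subsetDl. Qed.

(** Some vertex has value at least 1/2, so each round deletes a vertex. *)
Lemma rounding_terminates H R0 : (forall u, u \in verts H -> 0 <= c u) ->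
  exists F, rounding_returns PW c H R0 F.
Proof.
have [n] := ubnP #|verts H|; elim: n H R0 => // n IH H R0.
rewrite ltnS => Hn hc.
have [cyc|acyc] := boolP (has_cycle H); last by exists R0; apply: rounding_stop.
have [_ _ [u uH xu] _] := hPW cyc hc.
have [||F HF] := IH (delete H (rounded H (PW H c)))
  (R0 :|: rounded H (PW H c)).
- apply: leq_trans Hn; apply: proper_card; rewrite verts_delete.
  apply/properP; split; first exact: subsetDl.
  by exists u; rewrite // !inE uH xu.
- by move=> v; rewrite verts_delete => /setDP[/hc].
by exists F; apply: rounding_step.
Qed.

Lemma cost_rounded H x : (forall u, u \in verts H -> 0 <= c u) ->
  cost c (rounded H x) + 2 * dot (delete H (rounded H x)) c x
    <= 2 * dot H c x.
Proof.
move=> hc; rewrite /dot verts_delete [X in _ <= _ * X](big_setID (rounded H x)).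
rewrite /= (setIidPr _); last by apply/subsetP => u; rewrite inE => /andP[].
rewrite mulrDr lerD2r mulr_sumr; apply: ler_sum => u.
by rewrite inE => /andP[/hc cu xu]; nra.
Qed.

(** Separating [B] from the accumulator [R0] and quantifying over all [y] make the induction go
    through: the hypothesis for H - A is used at the witness [x]. *)
Lemma rounding_bound H R0 F : (forall u, u \in verts H -> 0 <= c u) ->
  rounding_returns PW c H R0 F ->
  exists B, [/\ F = R0 :|: B, feedback_vertex_set H B
    & forall y, strong_density H y -> cost c B <= 2 * dot H c y].
Proof.
move=> hc HF; elim: HF hc => {H R0 F} [H R0 acyc|H R0 F cyc _ IH] hc.
  exists set0; split; first by rewrite setU0.
    rewrite /feedback_vertex_set sub0set; apply: contra acyc.
    by apply: sub_has_cycle; apply/subsetP => f; rewrite inE => /andP[].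
  move=> y [y01 _]; rewrite /cost big_set0 mulr_ge0 // sumr_ge0 // => u uH.
  by have /andP[y0 _] := y01 u uH; rewrite mulr_ge0 ?hc.
set x := PW H c in IH *; set A := rounded H x in IH *.
have [_ xmin _ xSD] := hPW cyc hc.
have [|B [-> /andP[BH acB] Bcost]] := IH.
  by move=> v; rewrite verts_delete => /setDP[/hc].
rewrite verts_delete subsetD in BH; have /andP[BsH BA] := BH.
exists (A :|: B); split; first by rewrite setUA.
  rewrite /feedback_vertex_set subUset BsH andbT; apply/andP; split.
    by apply/subsetP => u; rewrite inE => /andP[].
  (* Every edge of H - (A ∪ B) is an edge of (H - A) - B. *)
  apply: contra acB; apply: sub_has_cycle; apply/subsetP => f.
  rewrite !inE => /andP[-> fAB] /=; apply/andP; split.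
    by apply: subset_trans fAB _; apply: setDS; apply: subsetUl.
  by rewrite -/(delete H A) [X in X :\: _]verts_delete setDDl.
move=> y ySD.
have -> : cost c (A :|: B) = cost c A + cost c B.
  rewrite /cost (big_setID A) /= setUK setDUl setDv set0U.
  by rewrite (setDidPl BA).
(* c(A) + c(B) ≤ c(A) + 2 c·x over H - A ≤ 2 c·x over H ≤ 2 c·y. *)
have := xmin y ySD; have := Bcost x xSD; have := cost_rounded x hc.
by rewrite -/x -/A; lra.
Qed.

Lemma dot_indicator G F : F \subset verts G ->
  dot G c [ffun u => (u \in F)%:R] = cost c F.
Proof.
move=> FG; rewrite /dot (big_setID F) /= (setIidPr FG) [X in _ + X]big1.
  by rewrite addr0; apply: eq_bigr => u uF; rewrite ffunE uF mulr1.
by move=> u /setDP[_ /negbTE uF]; rewrite ffunE uF mulr0.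
Qed.

End Rounding.

Theorem lemma21 (R : realFieldType) (T : finType)
    (PW : sgraph T -> {ffun T -> R} -> {ffun T -> R})
    (hPW : witness_producer PW)
    (G : sgraph T) (c : {ffun T -> R})
    (hc : forall u : T, u \in verts G -> 0 <= c u) :
  (exists F : {set T}, rounding_returns PW c G set0 F) /\
  (forall F : {set T}, rounding_returns PW c G set0 F ->
     feedback_vertex_set G F /\ cost c F <= 2 * OPT G c).
Proof.
split=> [|F /(rounding_bound hPW hc)[B [-> Bfvs Bcost]]].
  exact: rounding_terminates.
rewrite set0U; split=> //; have [[F0 F0fvs <-] _] := OPT_min G c.
have /andP[F0G _] := F0fvs.
by rewrite -(dot_indicator c F0G); apply: Bcost; apply: fvs_strong_density.
Qed.
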